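(* Let $\mathcal N$ be a finite, locally irreducible and strongly connected agent network with total alphabet $A$ and total state space $Q$. Let $\mathbf x\in\mathbb N^A\setminus\{\mathbf 0\}$ and let $R:=A\setminus\mathrm{supp}(\mathbf x)$, where $\mathrm{supp}(\mathbf x)=\{a\in A:\mathbf x(a)\neq0\}$. Then, for $\mathbf q\in Q$, $\mathbf x.\mathbf q$ is an $\mathcal N$-recurrent configuration if and only if $\mathbf q$ is an $\mathcal N_R$-recurrent state, where $\mathcal N_R$ is the thief network based on $\mathcal N$ with messages restricted to $R$.
   Context: Abelian networks. $\mathbb N=\{0,1,2,\dots\}$. Let $G=(V,E)$ be a finite directed graph (self-loops and multiple edges allowed). An abelian network $\mathcal N$ on $G$ assigns to each $v\in V$ a nonempty input alphabet $A_v$ and a nonempty state space $Q_v$ (the $A_v$ pairwise disjoint), maps $T_a:Q_v\to Q_v$ for $a\in A_v$, and, for each edge $e$ from $v$ to $u$, a message-passing function $T_e:Q_v\times A_v\to A_u^*$ (free monoid of words), such that for all $v$, $a,b\in A_v$, $q\in Q_v$: $T_aT_b=T_bT_a$, and for every edge $e$ out of $v$ the words $T_e(q,a)T_e(T_a(q),b)$ and $T_e(q,b)T_e(T_b(q),a)$ agree up to permuting letters. Put $A=\bigsqcup_v A_v$, $Q=\prod_v Q_v$; $\mathcal N$ is finite if $A$ and $Q$ are finite. For a word $w\in A^*$, $|w|\in\mathbb N^A$ counts the occurrences of each letter. For $a\in A_v$, $\mathbf q\in Q$: $t_a\mathbf q$ is $\mathbf q$ with $\mathbf q(v)$ replaced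 by $T_a(\mathbf q(v))$, and $\mathbf M_a(\mathbf q)=\sum_{e\text{ out of }v}|T_e(\mathbf q(v),a)|\in\mathbb N^A$. A configuration is a pair $\mathbf x.\mathbf q$ with $\mathbf x\in\mathbb Z^A$, $\mathbf q\in Q$; $\pi_a(\mathbf x.\mathbf q)=(\mathbf x+\mathbf M_a(\mathbf q)-|a|).t_a\mathbf q$. For $w=a_1\cdots a_\ell$: $t_w=t_{a_\ell}\cdots t_{a_1}$, $\mathbf M_w(\mathbf q)=\sum_i\mathbf M_{a_i}(t_{a_1\cdots a_{i-1}}\mathbf q)$, $\pi_w=\pi_{a_\ell}\cdots\pi_{a_1}$; these depend only on $|w|$, so $t_{\mathbf n},\mathbf M_{\mathbf n},\pi_{\mathbf n}$ are defined for $\mathbf n\in\mathbb N^A$. The word $w$ is legal for $\mathbf x.\mathbf q$ if, with $\mathbf x_i.\mathbf q_i=\pi_{a_1\cdots a_i}(\mathbf x.\mathbf q)$, $\mathbf x_{i-1}(a_i)\ge1$ for all $1\le i\le\ell$. Write $\mathbf x.\mathbf q\xrightarrow{w}\mathbf x'.\mathbf q'$ if $w$ is legal for $\mathbf x.\mathbf q$ and $\pi_w(\mathbf x.\mathbf q)=\mathbf x'.\mathbf q'$; write $\mathbf x.\mathbf q\to\mathbf x'.\mathbf q'$ if this holds for some (possibly empty) $w$. Local recurrence, kernel, production matrix. $\mathcal N$ is locally irreducible if for all $\mathbf q,\mathbf q'\in Q$ there are words $w,w'$ with $t_w\mathbf q=t_{w'}\mathbf q'$. For $\mathcal N$ finite,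 let $e$ be the product of all idempotents of the finite commutative monoid generated by the $t_a$ in $\mathrm{End}(Q)$; $\mathrm{Loc}(\mathcal N)=eQ$. The total kernel is $K=\{\mathbf z\in\mathbb Z^A: t_{\mathbf z^+}\mathbf q=t_{\mathbf z^-}\mathbf q\ \forall\mathbf q\in\mathrm{Loc}(\mathcal N)\}$, with $\mathbf z^{\pm}\in\mathbb N^A$ the positive/negative parts of $\mathbf z$. For $\mathcal N$ finite and locally irreducible, the production matrix $P$ is the unique rational $A\times A$ matrix with $P\mathbf k=\mathbf M_{\mathbf k}(\mathbf q)$ for all $\mathbf k\in K\cap\mathbb N^A$ and $\mathbf q\in\mathrm{Loc}(\mathcal N)$. $\mathcal N$ is strongly connected if the digraph on $A$ with an edge $(a,b)$ whenever $P_{ba}>0$ is strongly connected. Agent and thief networks. An agent network is an abelian network with $\sum_{b\in A}\mathbf M_a(\mathbf q)(b)=1$ for all $a\in A$, $\mathbf q\in Q$; its production matrix has spectral radius $1$. For $R\subseteq A$, the thief network $\mathcal N_R$ has the same underlying digraph, alphabets, state spaces and transition maps as $\mathcal N$, but all letters of $A\setminus R$ are deleted from all messages, so its message-passing vectors are $\mathbf M_a^{\mathcal N_R}(\mathbf q)(b)=\mathbf M_a^{\mathcal N}(\mathbf q)(b)$ if $b\in R$ and $0$ otherwise (letters of $A\setminus R$ can still be processed). For $R\subsetneq A$ it is finite, locally irreducible and its production matrix has spectral radius $<1$ (subcritical). Recurrence. Two configurations are legally related if there is $\mathbf x_3.\mathbf q_3$ with $\mathbf x_1.\mathbf q_1\to\mathbf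 x_3.\mathbf q_3$ and $\mathbf x_2.\mathbf q_2\to\mathbf x_3.\mathbf q_3$ (an equivalence relation); components of the trajectory digraph are the equivalence classes. $\mathcal N$-recurrent configuration: $\mathbf x.\mathbf q$ has a nonempty legal execution in $\mathcal N$, and every configuration $\mathbf x'.\mathbf q'$ legally related to $\mathbf x.\mathbf q$ in $\mathcal N$ satisfies $\mathbf x'.\mathbf q'\to\mathbf x.\mathbf q$. An infinite walk is a sequence of configurations $\mathbf x_i.\mathbf q_i$ and letters $a_i$ with $\mathbf x_{i-1}.\mathbf q_{i-1}\xrightarrow{a_i}\mathbf x_i.\mathbf q_i$ for consecutive indices in $I$, $I$ being $\mathbb Z_{\le0}$, $\mathbb Z_{\ge0}$ or $\mathbb Z$; it is diverse if each letter of $A$ equals $a_i$ for infinitely many $i$. A component is recurrent if it contains a diverse infinite walk. A state $\mathbf q$ of a finite, locally irreducible, subcritical network is recurrent if the component of the configuration $\mathbf 0.\mathbf q$ is a recurrent component of that network. *)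

(* Defs.v *)
From HB Require Import structures.
From mathcomp Require Import all_boot all_order all_algebra.
From mathcomp Require Import boolp classical_sets cardinality.

Set Implicit Arguments.
Unset Strict Implicit.
Unset Printing Implicit Defensive.

Import Order.TTheory GRing.Theory Num.Theory.

Local Open Scope ring_scope.

(* Multiple edges and self-loops are allowed. *)
Record digraph := Digraph {
  vertex : finType;
  edge : finType;
  src : edge -> vertex;
  tgt : edge -> vertex }.

Record network (G : digraph) := Network {
  alphabet : vertex G -> finType;
  states : vertex G -> finType;
  transition : forall v, alphabet v -> states v -> states v;
  message : forall e : edge G,
    states (src e) -> alphabet (src e) -> seq (alphabet (tgt e));
  alphabet_gt0 : forall v, (0 < #|alphabet v|)%N;
  states_gt0 : forall v, (0 < #|states v|)%N;
  transitionC : forall v (a b : alphabet v) (q : states v),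
    transition a (transition b q) = transition b (transition a q);
  messageC : forall (e : edge G) (a b : alphabet (src e)) (q : states (src e)),
    perm_eq (message q a ++ message (transition a q) b)
            (message q b ++ message (transition b q) a) }.

(* The total alphabet: the tagged sum makes the alphabets disjoint. *)
Definition letter G (N : network G) : finType := {v : vertex G & alphabet N v}.

Definition state G (N : network G) : finType :=
  {dffun forall v : vertex G, states N v}.

Section Network.
Variables (G : digraph) (N : network G).
Implicit Types (a b : letter N) (q : state N) (w : seq (letter N)).

(* t_a *)
Definition trans a q : state N :=
  [ffun v => dfwith q (transition (tagged a) (q (tag a))) v].

(* The word sent along [e] when [a] is processed in state [q], as a word in the
   total alphabet; it is empty unless [e] is an edge out of the vertex of [a]. *)
Definition edge_word (e : edge G) a q : seq (letter N) :=
  untag [::]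
    (fun a' : alphabet N (src e) =>
       [seq Tagged (alphabet N) c | c <- message (q (src e)) a'])
    a.

(* M_a(q) *)
Definition msg a q : {ffun letter N -> nat} :=
  [ffun b => (\sum_(e : edge G | src e == tag a)
                count_mem b (edge_word e a q))%N].

Definition transw w q : state N := foldl (fun q' a => trans a q') q w.

Fixpoint msgw w q : {ffun letter N -> nat} :=
  if w is a :: w' then msg a q + msgw w' (trans a q) else 0.

(* [transw w], [msgw w] depend only on the letter counts of [w], so t_n and M_n
   are computed on one chosen word with letter counts [n]. *)
Definition word_of (n : {ffun letter N -> nat}) : seq (letter N) :=
  flatten [seq nseq (n a) a | a <- enum (letter N)].

Definition transn n q : state N := transw (word_of n) q.

Definition msgn n q : {ffun letter N -> nat} := msgw (word_of n) q.

Definition to_int (n : {ffun letter N -> nat}) : {ffun letter N -> int} :=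
  [ffun a => (n a)%:Z].

Definition config : Type := ({ffun letter N -> int} * state N)%type.

(* pi_a *)
Definition process a (c : config) : config :=
  ([ffun b => c.1 b + (msg a c.2 b)%:Z - (b == a)%:Z], trans a c.2).

Definition processw w (c : config) : config :=
  foldl (fun c' a => process a c') c w.

Fixpoint legal w (c : config) : bool :=
  if w is a :: w' then (1 <= c.1 a) && legal w' (process a c) else true.

Definition exec w (c c' : config) : Prop := legal w c /\ processw w c = c'.

Definition reach (c c' : config) : Prop := exists w, exec w c c'.

Definition locally_irreducible : Prop :=
  forall q q', exists w w', transw w q = transw w' q'.

(* Local recurrence. *)

Definition ffcomp (f g : {ffun state N -> state N}) : {ffun state N -> state N} :=
  [ffun q => f (g q)].

Definition trans_monoid : {set {ffun state N -> state N}} :=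
  [set f : {ffun state N -> state N} |
    `[< exists w, f = [ffun q => transw w q] >]]%SET.

(* The monoid is commutative, so the order of the factors is irrelevant. *)
Definition idempotent_prod : {ffun state N -> state N} :=
  \big[ffcomp/[ffun q => q]]_(f in trans_monoid | ffcomp f f == f) f.

Definition Loc : {set state N} :=
  [set idempotent_prod q | q in [set: state N]]%SET.

Definition pos_part (z : {ffun letter N -> int}) : {ffun letter N -> nat} :=
  [ffun a => `|Num.max (z a) 0|%N].

Definition neg_part (z : {ffun letter N -> int}) : {ffun letter N -> nat} :=
  [ffun a => `|Num.max (- z a) 0|%N].

Definition total_kernel : set {ffun letter N -> int} :=
  [set z | forall q, q \in Loc ->
     transn (pos_part z) q = transn (neg_part z) q]%classic.

Definition to_col (n : {ffun letter N -> nat}) : 'cV[rat]_#|letter N| :=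
  \col_i (n (enum_val i))%:R.

(* Rows and columns are indexed by letters through [enum_rank].  If [N] is
   locally irreducible then exactly one matrix has this property: some positive
   multiple of each unit vector lies in the total kernel. *)
Definition is_production_matrix (P : 'M[rat]_#|letter N|) : Prop :=
  forall k : {ffun letter N -> nat}, total_kernel (to_int k) ->
  forall q, q \in Loc -> P *m to_col k = to_col (msgn k q).

Definition production_edge (P : 'M[rat]_#|letter N|) : rel (letter N) :=
  fun a b => 0 < P (enum_rank b) (enum_rank a).

Definition strongly_connected : Prop :=
  exists2 P, is_production_matrix P & forall a b, connect (production_edge P) a b.

Definition agent_network : Prop :=
  forall a q, (\sum_(b : letter N) msg a q b)%N = 1%N.

(* Recurrence. *)

Definition legally_related (c1 c2 : config) : Prop :=
  exists c3, reach c1 c3 /\ reach c2 c3.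

Definition component (c : config) : set config :=
  [set c' | legally_related c c']%classic.

Definition recurrent_config (c : config) : Prop :=
  (exists2 w, w <> [::] & exists c', exec w c c') /\
  (forall c', legally_related c c' -> reach c' c).

Definition walk_index (I : set int) : Prop :=
  [\/ I = [set i | i <= 0]%classic,
      I = [set i | 0 <= i]%classic | I = setT].

Definition infinite_walk (I : set int) (c : int -> config) (l : int -> letter N) :
    Prop :=
  walk_index I /\
  forall i : int, I (i - 1) -> I i -> exec [:: l i] (c (i - 1)) (c i).

Definition diverse (I : set int) (l : int -> letter N) : Prop :=
  forall a, infinite_set [set i | I i /\ l i = a]%classic.

Definition recurrent_component (C : set config) : Prop :=
  exists I c l, [/\ infinite_walk I c l, diverse I l & forall i, I i -> C (c i)].

(* Meant for locally irreducible subcritical networks. *)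
Definition recurrent_state q : Prop :=
  recurrent_component (component (0, q)).

Definition supp (x : {ffun letter N -> nat}) : {set letter N} :=
  [set a | x a != 0%N]%SET.

End Network.

Section Thief.
Variables (G : digraph) (N : network G) (R : {set letter N}).

Definition thief_message (e : edge G) (q : states N (src e))
    (a : alphabet N (src e)) : seq (alphabet N (tgt e)) :=
  [seq c <- message q a | Tagged (alphabet N) c \in R].

Lemma thief_messageC (e : edge G) (a b : alphabet N (src e))
    (q : states N (src e)) :
  perm_eq (thief_message q a ++ thief_message (transition a q) b)
          (thief_message q b ++ thief_message (transition b q) a).
Proof. by rewrite /thief_message -!filter_cat perm_filter // messageC. Qed.

Definition thief : network G :=
  Network (@alphabet_gt0 G N) (@states_gt0 G N) (@transitionC G N)
    thief_messageC.

Lemma thief_msg (a : letter N) (q : state N) (b : letter N) :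
  msg (N := thief) a q b = if b \in R then msg a q b else 0%N.
Proof.
rewrite !ffunE.
have H e : count_mem (b : letter thief) (edge_word (N := thief) e a q)
   = if b \in R then count_mem b (edge_word e a q) else 0%N.
  rewrite /edge_word; case: (eqVneq (tag a) (src e)) => [p|p]; last first.
    rewrite !untag_dflt //; first by case: ifP.
  rewrite !(untagE _ _ p) /= /thief_message -filter_map count_filter.
  case: ifP => bR; last first.
    apply/eqP; rewrite -leqn0 leqNgt -has_count; apply/hasPn => c _ /=.
    by apply/negP => /andP [/eqP -> inR]; move/negP: bR; apply.
  by apply: eq_count => c /=; case: eqP => // ->; apply/andb_idr.
by case: ifP => bR; [apply: eq_bigr | apply: big1] => e _; rewrite H bR.
Qed.

End Thief.

(* Main.v *)
Require Import Defs.
From mathcomp Require Import all_boot all_order all_algebra.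
From mathcomp Require Import boolp classical_sets cardinality.
From mathcomp Require Import zify.

(* Call a word [u] balanced at a state [p] if it fixes [p] and sends each letter
   as often as it consumes it.  Following a single agent around a cycle gives a
   balanced word; strong connectivity forces it to use every letter, and by
   local irreducibility it is balanced at every locally recurrent state.
   If [x.q] is recurrent then some legal cycle [u] at [x.q] uses all letters.
   Supplying in advance the letters of [u] in [supp x], the thief network can
   execute [u] down to [0.q] arbitrarily often, which gives a diverse walk.
   Conversely, walks that can still reach [0.q] cannot be infinite forwards by
   the least action principle, so [q] has an arbitrarily rich history in the
   thief network.  Run a balanced [u] legally from [x.q] as far as possible.
   Counting agents, the unused part [v] of [u] avoids [supp x].  Comparing with
   the shortest suffix of the history that contains [v] shows that [v] is empty.
   Hence [x.q] lies on a legal cycle using all letters, and is recurrent by the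
   exchange lemma. *)

Set Implicit Arguments.
Unset Strict Implicit.
Unset Printing Implicit Defensive.

Import Order.TTheory GRing.Theory Num.Theory.

Local Open Scope nat_scope.

(** * Finite sets and sequences *)

Lemma finite_repeat (T : finType) (f : nat -> T) :
  exists i j, i < j <= #|T| /\ f i = f j.
Proof.
have: ~~ injectiveb (fun i : 'I_#|T|.+1 => f i).
  by apply/injectiveP => /leq_card; rewrite card_ord ltnn.
case/injectivePn => i [j]; rewrite -val_eqE /= neq_ltn => /orP [ij|ji] fij.
  by exists i, j; rewrite ij -ltnS ltn_ord.
by exists j, i; rewrite ji -ltnS ltn_ord.
Qed.

Lemma count_flatten_nseq (T : Type) (p : pred T) (w : seq T) k :
  count p (flatten (nseq k w)) = k * count p w.
Proof. by rewrite count_flatten map_nseq sumn_nseq mulnC. Qed.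

Lemma sum_count_mem (T : finType) (s : seq T) : \sum_a count_mem a s = size s.
Proof.
elim: s => [|a s IH]; first by rewrite big1.
rewrite big_split /= IH (bigD1 a) //= eqxx big1 // => b ba.
by rewrite eq_sym (negbTE ba).
Qed.

(** Letters are dropped from the front of [s] until losing the next one would break the domination
    of [r]; that letter is [a], and its count is tight. *)
Lemma shortest_suffix (T : eqType) (s : seq T) (r : T -> nat) :
    (forall a, r a <= count_mem a s) -> (exists a, 0 < r a) ->
  exists s1 a s2, [/\ s = s1 ++ a :: s2, forall b, r b <= count_mem b (a :: s2),
    0 < r a & count_mem a (a :: s2) = r a].
Proof.
move=> rs [a0 ra0]; elim: s rs => [|b s IH] rs.
  by have := leq_trans ra0 (rs a0).
case: (pselect (forall a, r a <= count_mem a s)) => [/IH|/existsNP [a]].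
  by move=> [s1 [a [s2 [-> r_le ra rE]]]]; exists (b :: s1), a, s2.
move/negP; rewrite -ltnNge => sa.
have ab : b = a.
  apply/eqP; have := leq_trans sa (rs a).
  by rewrite /= -[ltnLHS]add0n ltn_add2r lt0b.
rewrite -ab in sa; exists [::], b, s; split=> //; first exact: leq_trans sa.
by apply/eqP; rewrite eqn_leq rs /= eqxx add1n sa.
Qed.

(** * Abelian property and exchange *)

Section AbelianProperty.
Variables (G : digraph) (N : network G).
Implicit Types (a b : letter N) (q : state N) (w v : seq (letter N)).
Implicit Types (c : config N).

Lemma trans_in a q : trans a q (tag a) = transition (tagged a) (q (tag a)).
Proof. by rewrite ffunE dfwith_in. Qed.

Lemma trans_Tagged (u : vertex G) (a : alphabet N u) q :
  trans (Tagged (alphabet N) a) q u = transition a (q u).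
Proof. exact: (trans_in (Tagged (alphabet N) a)). Qed.

Lemma trans_out a q (u : vertex G) : u != tag a -> trans a q u = q u.
Proof. by move=> ua; rewrite ffunE dfwith_out // eq_sym. Qed.

Lemma transC a b q : trans a (trans b q) = trans b (trans a q).
Proof.
apply/ffunP => v; case: (eqVneq (tag a) (tag b)) => [ab|ab].
  case: (eqVneq v (tag a)) => [->|va]; last by rewrite !trans_out // -?ab.
  case: a b ab => [va a] [vb b] /= ab; subst vb.
  by rewrite !trans_Tagged transitionC.
case: (eqVneq v (tag a)) => [->|va].
  by rewrite trans_in !(@trans_out b) // trans_in.
case: (eqVneq v (tag b)) => [->|vb]; last by rewrite !trans_out.
by rewrite trans_in !(@trans_out a) ?trans_in // eq_sym.
Qed.

Lemma msg_trans_out a b q : tag a != tag b -> msg b (trans a q) = msg b q.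
Proof.
move=> ab; apply/ffunP => c; rewrite !ffunE; apply: eq_bigr => e /eqP eb.
by rewrite /edge_word trans_out // eb eq_sym.
Qed.

(** Letters at different vertices do not affect each other's messages; at a common vertex this is
    [messageC] summed over the outgoing edges. *)
Lemma msg_transC a b q :
  (msg a q + msg b (trans a q) = msg b q + msg a (trans b q))%R.
Proof.
case: (eqVneq (tag a) (tag b)) => [ab|ab]; last first.
  by rewrite msg_trans_out // msg_trans_out 1?eq_sym // addrC.
apply/ffunP => c; rewrite !ffunE -ab -!big_split /=.
apply: eq_bigr => e /eqP ea.
case: a b ab ea => [va a] [vb b] /= ab ea; subst vb va.
rewrite /edge_word.
rewrite !(untagE _ _ (erefl : tag (Tagged (alphabet N) _) = src e)) /=.
rewrite !trans_Tagged.
have /(perm_map (Tagged (alphabet N)))/permP/(_ (pred1 c)) :=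
  messageC a b (q (src e)).
by rewrite !map_cat !count_cat.
Qed.

Lemma transw_cat w v q : transw (w ++ v) q = transw v (transw w q).
Proof. exact: foldl_cat. Qed.

Lemma msgw_cons a w q b :
  msgw (a :: w) q b = msg a q b + msgw w (trans a q) b.
Proof. by rewrite [LHS]ffunE. Qed.

Lemma msgw_cat w v q b :
  msgw (w ++ v) q b = msgw w q b + msgw v (transw w q) b.
Proof.
elim: w q => [|a w IH] q; first by rewrite ffunE.
by rewrite cat_cons !msgw_cons IH addnA.
Qed.

Lemma perm_word w v q : perm_eq w v ->
  transw w q = transw v q /\ msgw w q = msgw v q.
Proof.
have pull l a r p : transw (l ++ a :: r) p = transw (a :: l ++ r) p /\
    msgw (l ++ a :: r) p = msgw (a :: l ++ r) p.
  elim: l p => [//|b l IH] p /=; have [-> ->] := IH (trans b p).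
  by rewrite /= !addrA msg_transC transC.
elim: w v q => [|a w IH] v q; first by rewrite perm_sym => /perm_nilP ->.
move=> pv; have av : a \in v by rewrite -(perm_mem pv) mem_head.
move: pv; case/splitPr: av => l r pv.
have [-> ->] := pull l a r q.
have pw : perm_eq w (l ++ r).
  by rewrite -(perm_cons a) (perm_trans pv) // (perm_catCA l [:: a]).
by have [/= -> ->] := IH _ (trans a q) pw.
Qed.

Lemma transw_catC w v q : transw w (transw v q) = transw v (transw w q).
Proof.
by rewrite -!transw_cat; have [] := perm_word q (permEl (perm_catC v w)).
Qed.

Lemma msgw_catC w v q b :
  msgw w q b + msgw v (transw w q) b = msgw v q b + msgw w (transw v q) b.
Proof.
by rewrite -!msgw_cat; have [_ ->] := perm_word q (permEl (perm_catC w v)).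
Qed.

Lemma count_le_perm w v : (forall a, count_mem a w <= count_mem a v) ->
  exists u, perm_eq v (w ++ u).
Proof.
move=> /count_subseqP [s /perm_to_subseq [u vsu] ws]; exists u.
by rewrite (perm_trans vsu) // perm_cat2r perm_sym.
Qed.

Lemma msgw_mono w v q b : (forall a, count_mem a w <= count_mem a v) ->
  msgw w q b <= msgw v q b.
Proof.
move=> /count_le_perm [u /(perm_word q) [_ ->]].
by rewrite msgw_cat leq_addr.
Qed.

Lemma processwE w c :
  processw w c = ([ffun b => c.1 b + (msgw w c.2 b)%:Z - (count_mem b w)%:Z]%R,
                  transw w c.2).
Proof.
elim: w c => [|a w IH] [y q] /=.
  by congr pair; apply/ffunP => b; rewrite !ffunE addr0 subr0.
rewrite IH /=; congr pair; apply/ffunP => b.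
move: (msgw_cons a w q b) => /= msgE.
by rewrite [LHS]ffunE [RHS]ffunE /= msgE [in LHS]ffunE eq_sym; lia.
Qed.

Lemma processw1E w c b :
  ((processw w c).1 b = c.1 b + (msgw w c.2 b)%:Z - (count_mem b w)%:Z)%R.
Proof. by rewrite processwE ffunE. Qed.

Lemma processw2E w c : (processw w c).2 = transw w c.2.
Proof. by rewrite processwE. Qed.

Lemma perm_processw w v c : perm_eq w v -> processw w c = processw v c.
Proof.
move=> wv; rewrite !processwE; have [-> ->] := perm_word c.2 wv.
by congr pair; apply/ffunP => b; rewrite !ffunE (permP wv).
Qed.

Lemma processw_cat w v c : processw (w ++ v) c = processw v (processw w c).
Proof. exact: foldl_cat. Qed.

Lemma legal_cat w v c : legal (w ++ v) c = legal w c && legal v (processw w c).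
Proof. by elim: w c => [|a w IH] c //=; rewrite IH andbA. Qed.

Lemma exec_cat w v c c' c'' : exec w c c' -> exec v c' c'' ->
  exec (w ++ v) c c''.
Proof.
by move=> [lw <-] [lv <-]; split; rewrite ?legal_cat ?lw // processw_cat.
Qed.

Lemma reach_refl c : reach c c. Proof. by exists [::]. Qed.

Lemma reach_trans c c' c'' : reach c c' -> reach c' c'' -> reach c c''.
Proof. by move=> [w cw] [v cv]; exists (w ++ v); apply: exec_cat cw cv. Qed.

Lemma cycle_nseq w c k : exec w c c -> exec (flatten (nseq k w)) c c.
Proof. by move=> cw; elim: k => [|k IH] //; apply: exec_cat cw IH. Qed.

(* The first letter by which [w] overtakes [v] is available after [v], since
   by then it has received at least as many messages as in [w]. *)
Lemma legal_overtake w v c : legal w c ->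
  ~ (forall a, count_mem a w <= count_mem a v) ->
  exists2 a, count_mem a v < count_mem a w & (1 <= (processw v c).1 a)%R.
Proof.
elim/last_ind: w => [|w a IH]; first by move=> _ [].
rewrite -cats1 legal_cat /= andbT => /andP [lw xa] wv.
case: (pselect (forall a, count_mem a w <= count_mem a v));
  last first.
  move=> /(IH lw) [b vw xb]; exists b => //.
  by rewrite count_cat (leq_trans vw) ?leq_addr.
move=> le_wv; have va : count_mem a v = count_mem a w.
  apply/eqP; rewrite eqn_leq le_wv andbT leqNgt; apply/negP => lt_wv.
  apply: wv => b; rewrite count_cat /= addn0.
  by case: eqVneq => [<-|_]; rewrite ?addn1 ?addn0.
exists a; first by rewrite count_cat /= eqxx va addn1.
move: xa; rewrite !processw1E va.
have := msgw_mono c.2 a le_wv; lia.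
Qed.

Lemma legal_stuck c (n : letter N -> nat) :
  exists w, [/\ legal w c, forall a, count_mem a w <= n a &
    forall a, count_mem a w < n a -> ((processw w c).1 a < 1)%R].
Proof.
suff: forall k w, legal w c -> (forall a, count_mem a w <= n a) ->
    \sum_a (n a - count_mem a w) <= k ->
    exists w, [/\ legal w c, forall a, count_mem a w <= n a &
    forall a, count_mem a w < n a -> ((processw w c).1 a < 1)%R].
  by move=> /(_ _ [::]); apply; rewrite ?leqnn.
elim=> [|k IH] w lw wn sum_le.
  exists w; split=> // a; rewrite -subn_gt0.
  by move: sum_le; rewrite leqn0 sum_nat_eq0 => /forallP /(_ a) /eqP ->.
case: (pselect (exists a, count_mem a w < n a /\ (1 <= (processw w c).1 a)%R)).
  move=> [a [wa xa]]; apply: (IH (rcons w a)).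
  - by rewrite -cats1 legal_cat lw /= xa.
  - move=> b; rewrite -cats1 count_cat /= addn0.
    by case: eqVneq => [<-|_]; rewrite ?addn1 ?addn0.
  rewrite -ltnS; apply: leq_trans sum_le.
  rewrite (bigD1 a) //= [leqRHS](bigD1 a) //=.
  rewrite -cats1 count_cat /= eqxx -addSn leq_add //.
    by rewrite addn1 subnSK.
  by apply: leq_sum => b _; rewrite count_cat leq_sub2l // leq_addr.
move=> stuck; exists w; split=> // a wa; rewrite ltNge; apply/negP => xa.
by apply: stuck; exists a.
Qed.

Lemma least_action w v c : legal w c -> (forall a, (processw v c).1 a <= 0)%R ->
  forall a, count_mem a w <= count_mem a v.
Proof.
move=> lw v0; case: (pselect (forall a, count_mem a w <= count_mem a v)) => //.
by move=> /(legal_overtake lw) [b _]; have := v0 b; lia.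
Qed.

Lemma cycle_reach_back w c c' : exec w c c -> (forall a, a \in w) ->
  reach c c' -> reach c' c.
Proof.
move=> cw w_all [v [lv <-]].
have [lW eW] := cycle_nseq (size v) cw.
set W := flatten _ in lW eW.
have vW a : count_mem a v <= count_mem a W.
  rewrite count_flatten_nseq (leq_trans (count_size _ _)) // leq_pmulr //.
  by rewrite -has_count has_pred1.
have [v' [lv' v'W stuck]] := legal_stuck (processw v c)
  (fun a => count_mem a W - count_mem a v).
exists v'; split=> //; rewrite -processw_cat -[RHS]eW.
apply: perm_processw; apply/allP => a _ /=; rewrite count_cat.
case: (pselect (forall a, count_mem a W <= count_mem a (v ++ v'))) => [W_le|].
  by rewrite eqn_leq -leq_subRL ?v'W ?vW //= -count_cat W_le.
move=> /(legal_overtake lW) [b]; rewrite count_cat processw_cat => lt_b.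
by rewrite leNgt stuck // ltn_subRL.
Qed.

Lemma recurrent_cycle w c : w <> [::] -> (forall a, a \in w) ->
  exec w c c -> recurrent_config c.
Proof.
move=> w0 w_all cw; split; first by exists w => //; exists c.
move=> c' [c3 [cc3 c'c3]]; apply: reach_trans c'c3 _.
exact: cycle_reach_back cw w_all cc3.
Qed.

End AbelianProperty.

(** * Local recurrence *)

Section LocalRecurrence.
Variables (G : digraph) (N : network G).
Implicit Types (a b : letter N) (p q : state N) (u w v : seq (letter N)).

Lemma count_word_of (n : {ffun letter N -> nat}) a :
  count_mem a (word_of n) = n a.
Proof.
rewrite /word_of count_flatten -map_comp sumnE big_map big_enum /=.
rewrite (bigD1 a) //= big1 ?addn0; first by rewrite count_nseq /= eqxx mul1n.
by move=> b ba; rewrite count_nseq /= (negbTE ba).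
Qed.

Lemma transn_word (n : {ffun letter N -> nat}) w q :
  (forall a, n a = count_mem a w) -> transn n q = transw w q.
Proof.
move=> nw; apply: (proj1 (perm_word q _)).
by apply/allP => a _ /=; rewrite count_word_of nw.
Qed.

Lemma msgn_word (n : {ffun letter N -> nat}) w q :
  (forall a, n a = count_mem a w) -> msgn n q = msgw w q.
Proof.
move=> nw; apply: (proj2 (perm_word q _)).
by apply/allP => a _ /=; rewrite count_word_of nw.
Qed.

Lemma idempotent_prod_word :
  exists e, forall q, idempotent_prod N q = transw e q.
Proof.
rewrite /idempotent_prod.
apply: (big_ind (fun f : {ffun state N -> state N} =>
                   exists e, forall q, f q = transw e q)).
- by exists [::] => q; rewrite ffunE.
- move=> f g [v fv] [w gw]; exists (w ++ v) => q.
  by rewrite ffunE gw fv transw_cat.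
move=> f /andP []; rewrite inE => /asboolP [w ->] _.
by exists w => q; rewrite ffunE.
Qed.

(** The map of [w] is itself a factor of [idempotent_prod]; it commutes past the other factors and
    is absorbed by its own copy. *)
Lemma Loc_idempotent w q : (forall p, transw w (transw w p) = transw w p) ->
  q \in Loc N -> transw w q = q.
Proof.
move=> ww /imsetP [p _ ->].
pose f := [ffun q => transw w q].
have: f \in index_enum [the finType of {ffun state N -> state N}].
  exact: mem_index_enum.
rewrite /idempotent_prod; elim: (index_enum _) => [//|g r IH].
rewrite inE big_cons; case: eqP => [<- _|_ /= /IH {}IH].
  have -> : (f \in trans_monoid N) && (ffcomp f f == f).
    rewrite inE; apply/andP; split; first by apply/asboolP; exists w.
    by apply/eqP/ffunP => p'; rewrite !ffunE.
  by rewrite !ffunE ww.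
case: ifP => // /andP []; rewrite inE => /asboolP [v ->] _.
by rewrite !ffunE transw_catC IH.
Qed.

Lemma idempotent_power a : exists2 m, 0 < m &
  forall q, transw (nseq m a) (transw (nseq m a) q) = transw (nseq m a) q.
Proof.
have [i [j [/andP [ij _] Fij]]] := finite_repeat
  (fun k => [ffun q => transw (nseq k a) q] : {ffun state N -> state N}).
have step n q : i <= n ->
    transw (nseq (n + (j - i)) a) q = transw (nseq n a) q.
  move=> /subnKC <-; move/ffunP/(_ q): Fij; rewrite !ffunE => Fij.
  rewrite addnAC subnKC ?(ltnW ij) //.
  by rewrite !nseqD !transw_cat Fij.
have steps n q k : i <= n ->
    transw (nseq (n + k * (j - i)) a) q = transw (nseq n a) q.
  move=> ni; elim: k => [|k IH]; first by rewrite addn0.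
  by rewrite mulSn addnCA addnC step ?IH // (leq_trans ni) ?leq_addr.
(* The powers have preperiod [i] and period [j - i]; the exponent must be a positive multiple of the
   period and at least [i]. *)
exists (i.+1 * (j - i)); first by rewrite muln_gt0 subn_gt0.
move=> q; rewrite -transw_cat -nseqD steps //.
by rewrite (leq_trans (leqnSn i)) // leq_pmulr // subn_gt0.
Qed.

End LocalRecurrence.

(** * Balanced words *)

Section Balanced.
Variables (G : digraph) (N : network G).
Implicit Types (a b : letter N) (p q : state N) (u w v : seq (letter N)).

(** With [m] an idempotent power of [a], the vector of [m] copies of [a] lies in the total kernel,
    so on [Loc] these copies send [m * P_ba > 0] letters [b]. *)
Lemma production_edge_msg (P : 'M[rat]_#|letter N|) a b :
    is_production_matrix P -> production_edge P a b ->
  exists2 m, 0 < m & forall q, q \in Loc N ->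
    transw (nseq m a) q = q /\ 0 < msgw (nseq m a) q b.
Proof.
move=> prodP Pab; have [m m0 mm] := idempotent_power a.
have fixm q : q \in Loc N -> transw (nseq m a) q = q.
  exact: Loc_idempotent.
exists m => // q Lq; split; first exact: fixm.
pose k : {ffun letter N -> nat} := [ffun c => count_mem c (nseq m a)].
have kK : total_kernel (to_int k).
  move=> p Lp; rewrite (@transn_word _ _ _ (nseq m a)) ?fixm //.
    rewrite (@transn_word _ _ _ [::]) // => c.
    by rewrite !ffunE max_r // oppr_le0.
  by move=> c; rewrite !ffunE max_l.
have := prodP k kK q Lq; move/matrixP/(_ (enum_rank b) 0%R).
rewrite !mxE (bigD1 (enum_rank a)) //= big1 => [|i ia]; last first.
  rewrite !mxE ffunE count_nseq /=; case: eqP => [ai|_]; last by rewrite mulr0.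
  by rewrite ai enum_valK eqxx in ia.
rewrite addr0 !mxE !enum_rankK ffunE count_nseq /= eqxx mul1n.
rewrite (@msgn_word _ _ _ (nseq m a)) => [E|c]; last by rewrite ffunE.
by rewrite -(ltr0n rat) -E mulr_gt0 // ltr0n.
Qed.

Lemma msgw_size w q b : agent_network N -> msgw w q b <= size w.
Proof.
move=> agN; elim: w q => [|a w IH] q; first by rewrite ffunE.
rewrite msgw_cons /= -add1n leq_add ?IH // -(agN a q).
by rewrite (bigD1 b) //= leq_addr.
Qed.

(* Pushing [q] into [Loc] by a word [e] changes what a power of [a] sends by
   at most [size e] letters. *)
Lemma edge_msg_gt0 (P : 'M[rat]_#|letter N|) a b : agent_network N ->
    is_production_matrix P -> production_edge P a b ->
  exists k, forall q, 0 < msgw (nseq k a) q b.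
Proof.
move=> agN prodP Pab; have [m _ msg_m] := production_edge_msg prodP Pab.
have [e eE] := idempotent_prod_word N.
have many j q : q \in Loc N -> j <= msgw (nseq (j * m) a) q b.
  move=> Lq; have [fix_m pos_m] := msg_m q Lq.
  elim: j => [//|j IH].
  by rewrite mulSn nseqD msgw_cat fix_m -add1n leq_add.
exists ((size e).+1 * m) => q; set w := nseq _ a.
have Lq : transw e q \in Loc N by rewrite -eE imset_f ?inE.
have := many (size e).+1 _ Lq; have := msgw_size e (transw w q) b agN.
have := msgw_catC w e q b; rewrite -/w; lia.
Qed.

Definition balanced u p :=
  transw u p = p /\ forall b, msgw u p b = count_mem b u.

(** Processing [u] and [w] in either order sends the same total; as [u] fixes [p], the contribution
    of [w] at [p] cancels. *)
Lemma balanced_trans u p w : balanced u p -> balanced u (transw w p).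
Proof.
move=> [tu mu]; split=> [|b]; first by rewrite transw_catC tu.
by have := msgw_catC u w p b; rewrite tu mu addnC => /addnI ->.
Qed.

Lemma cycle_balanced (c : config N) u : exec u c c -> balanced u c.2.
Proof.
move=> [_ uE]; split; first by rewrite -processw2E uE.
by move=> b; have := processw1E u c b; rewrite uE; lia.
Qed.

Lemma balanced_perm u v q : perm_eq u v -> balanced u q -> balanced v q.
Proof.
move=> uv [tu mu]; have [tE mE] := perm_word q uv.
by split=> [|b]; rewrite -?tE -?mE ?tu // mu (permP uv).
Qed.

Lemma transw_flatten_nseq u p k :
  transw u p = p -> transw (flatten (nseq k u)) p = p.
Proof. by move=> tu; elim: k => [//|k IH]; rewrite /= transw_cat tu. Qed.

Lemma balanced_nseq u p k : balanced u p -> balanced (flatten (nseq k u)) p.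
Proof.
move=> [tu mu]; split=> [|b]; first exact: transw_flatten_nseq.
elim: k => [|k IH] /=; first by rewrite ffunE.
by rewrite msgw_cat tu mu IH count_cat.
Qed.

(** The letters of [u] are closed under production edges: if [a] occurs in [u], enough repetitions
    of [u] send a letter [b], and by balance they also consume one. *)
Lemma balanced_full u p : strongly_connected N -> agent_network N ->
  u <> [::] -> balanced u p -> forall a, a \in u.
Proof.
move=> [P prodP conn] agN u0 bu.
have step a b : production_edge P a b -> a \in u -> b \in u.
  move=> /(edge_msg_gt0 agN prodP) [k msg_k] au.
  have [_ /(_ b)] := balanced_nseq k bu.
  rewrite count_flatten_nseq => E.
  suff: 0 < k * count_mem b u.
    by rewrite muln_gt0 -has_count has_pred1 => /andP [].
  rewrite -E (leq_trans (msg_k p)) // msgw_mono // => c.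
  rewrite count_nseq count_flatten_nseq mulnC leq_mul2l /=.
  case: (eqVneq a c) => [<-|_]; last by rewrite orbT.
  by rewrite -has_count has_pred1 au orbT.
case: u u0 bu step => [//|a0 u] _ bu step a.
have /connectP [s s_path ->] := conn a0 a.
move: s_path (mem_head a0 u); move: {1 2 4}a0.
elim: s => [//|b s IH] c /= /andP [cb sp] /(step _ _ cb); exact: IH.
Qed.

(* A single agent moves deterministically on the finite set of pairs (position,
   state), so it eventually cycles, and a cycle enters each letter as often as
   it leaves it. *)
Lemma balanced_exists a q : agent_network N ->
  exists u p, u <> [::] /\ balanced u p.
Proof.
move=> agN.
have next_ex (s : letter N * state N) :
    exists b, forall c, msg s.1 s.2 c = (b == c).
  have : \sum_b msg s.1 s.2 b == 1 by rewrite agN.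
  case/sum_nat_eq1 => b [_ b1 b0]; exists b => c.
  by case: eqVneq => [<-|bc] //; apply: b0; rewrite // eq_sym.
have [next nextE] := choice next_ex.
pose F s := (next s, trans s.1 s.2).
have trajE d s : let w := [seq x.1 | x <- traject F s d] in
    transw w s.2 = (iter d F s).2 /\
    forall b, (s.1 == b) + msgw w s.2 b = count_mem b w + ((iter d F s).1 == b).
  elim: d s => [|d IH] s; first by split=> // b; rewrite ffunE addn0.
  have [tw mw] := IH (F s); rewrite trajectS map_cons iterSr; split=> // b.
  by rewrite msgw_cons nextE mw addnA.
have [i [j [/andP [ij _] Fij]]] := finite_repeat (fun k => iter k F (a, q)).
set s := iter i F (a, q) in Fij.
have cyc : iter (j - i) F s = s by rewrite -iterD subnK // ltnW.
have [tw mw] := trajE (j - i) s.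
exists [seq x.1 | x <- traject F s (j - i)], s.2; split.
  by move/(congr1 size)/eqP; rewrite size_map size_traject subn_eq0 leqNgt ij.
split=> [|b]; first by rewrite tw cyc.
by apply: (@addnI (s.1 == b)); rewrite mw cyc addnC.
Qed.

(* A word with many copies of each letter sends every state into the cyclic
   part of the action of [enum (letter N)]; by irreducibility the balance of
   [u] is independent of the state there. *)
Lemma balanced_saturated u p h q : locally_irreducible N -> balanced u p ->
  (forall a, #|{: state N}| <= count_mem a h) -> balanced u (transw h q).
Proof.
move=> irrN bu h_big; set g := enum (letter N).
have count_g a k : count_mem a (flatten (nseq k g)) = k.
  by rewrite count_flatten_nseq count_uniq_mem ?enum_uniq // mem_enum muln1.
have [i [j [/andP [ij jQ] Fij]]] :=
  finite_repeat (fun k => transw (flatten (nseq k g)) q).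
have /count_le_perm [r hr] a :
    count_mem a (flatten (nseq i g)) <= count_mem a h.
  by rewrite count_g (leq_trans (ltnW ij)) // (leq_trans jQ).
have [-> _] := perm_word q hr; rewrite transw_cat; apply: balanced_trans.
set p1 := transw _ q.
have fix1 : transw (flatten (nseq (j - i) g)) p1 = p1.
  by rewrite -transw_cat -flatten_cat -nseqD subnKC ?(ltnW ij).
(* Irreducibility merges [p1] with [p]. Completing [w] to a word [W] that fixes [p1] then exhibits
   [p1] as an image of [p], where [u] is balanced. *)
have [w [w' ww']] := irrN p1 p.
set W := flatten (nseq (size w) (flatten (nseq (j - i) g))).
have /count_le_perm [v Wv] a : count_mem a w <= count_mem a W.
  rewrite count_flatten_nseq count_g (leq_trans (count_size _ _)) //.
  by rewrite leq_pmulr // subn_gt0.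
have <- : transw v (transw w p1) = p1.
  by rewrite -transw_cat -(proj1 (perm_word p1 Wv)) transw_flatten_nseq.
by rewrite ww'; do 2!apply: balanced_trans.
Qed.

End Balanced.

(** * Infinite walks *)

Section Walks.
Variables (G : digraph) (N : network G).
Implicit Types (a b : letter N) (q : state N) (u w v : seq (letter N)).
Implicit Types (c : config N).

(** Nothing is legal at [0.q], so the common successor is [0.q] itself. *)
Lemma component0_reach q c : component ((0%R, q) : config N) c ->
  reach c (0%R, q).
Proof.
move=> [c3 [[w [lw <-]] rc]].
by case: w lw rc => [//|a w] /=; rewrite ffunE.
Qed.

Lemma forward_walk (I : set int) (c : int -> config N) l :
    infinite_walk I c l -> (forall n : nat, I (Posz n)) ->
  forall n : nat, exists2 w, size w = n & exec w (c 0%R) (c (Posz n)).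
Proof.
move=> [_ walk] Inat; elim=> [|n [w sw cw]]; first by exists [::].
have := walk (Posz n.+1).
rewrite -addn1 PoszD addrK => /(_ (Inat n) (Inat _)) step.
exists (w ++ [:: l (n%:Z + 1)%R]); first by rewrite size_cat sw.
exact: exec_cat step.
Qed.

(** By least action, no legal execution is longer than a word leading to [0.q]. *)
Lemma no_forward_walk (I : set int) (c : int -> config N) l q :
    infinite_walk I c l -> (forall n : nat, I (Posz n)) ->
  ~ reach (c 0%R) (0%R, q).
Proof.
move=> walk Inat [v [_ vE]].
have [w sw [lw _]] := forward_walk walk Inat (size v).+1.
have v0 a : ((processw v (c 0%R)).1 a <= 0)%R by rewrite vE /= ffunE.
have [r /perm_size] := count_le_perm (least_action lw v0).
by rewrite size_cat sw addSn => /eqP; rewrite ltn_eqF // ltnS leq_addr.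
Qed.

Lemma backward_walk (c : int -> config N) l i :
    infinite_walk [set i | (i <= 0)%R]%classic c l -> (i <= 0)%R ->
  forall k : nat, exists w, exec w (c (i - k%:Z)%R) (c i) /\
    forall j : nat, j < k -> l (i - j%:Z)%R \in w.
Proof.
move=> [_ walk] i0; elim=> [|k [w [cw lw]]].
  by exists [::]; rewrite subr0.
exists (l (i - k%:Z)%R :: w); split.
  rewrite -addn1 PoszD opprD addrA -cat1s.
  by apply: exec_cat cw; apply: walk => /=; lia.
by move=> j; rewrite ltnS leq_eqVlt inE => /orP [/eqP ->|/lw ->];
  rewrite ?eqxx ?orbT.
Qed.

Lemma backward_walk_full (c : int -> config N) l i m :
    infinite_walk [set i | (i <= 0)%R]%classic c l ->
    diverse [set i | (i <= 0)%R]%classic l -> (i <= 0)%R ->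
  exists j w,
    [/\ (j <= 0)%R, exec w (c j) (c i) & forall a, m <= count_mem a w].
Proof.
move=> walk div; elim: m i => [|m IH] i i0; first by exists i, [::].
(* Otherwise all visits to [a] have index of absolute value below that of [i], against diversity. *)
have visit a : exists k : nat, l (i - k%:Z)%R = a.
  apply: contrapT => nk; apply: (div a).
  apply: (@sub_finite_set _ _ [set (- n%:Z)%R | n in `I_`|i|%N]%classic).
    move=> j [/= j0 lj]; exists `|j|%N; last by lia.
    rewrite /= ltnNge; apply/negP => ij; apply: nk; exists (`|j| - `|i|)%N.
    by rewrite -lj; congr l; lia.
  exact/finite_image/finite_II.
have [k kE] := choice visit.
have [w [cw lw]] := backward_walk walk i0 (\max_a k a).+1.
have [|j [v [j0 cv mv]]] := IH (i - (\max_a k a).+1%:Z)%R; first by lia.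
exists j, (v ++ w); split=> // [|a]; first exact: exec_cat cv cw.
rewrite count_cat -addn1 leq_add // -has_count has_pred1 -(kE a) lw //.
by rewrite ltnS leq_bigmax.
Qed.

Lemma recurrent_history q m n : recurrent_state q ->
  exists c c' w v, [/\ exec w c c', exec v c' (0%R, q),
    forall a, m <= count_mem a w & forall a, n <= count_mem a v].
Proof.
move=> [I [c [l [walk div comp]]]].
have I0 : I 0%R by have [[->|->|->] _] := walk.
have [v0 cv0] := component0_reach (comp _ I0).
have [I_le|Inat] :
    I = [set i | (i <= 0)%R]%classic \/ forall n : nat, I (Posz n).
  by have [[->|->|->] _] := walk; [left|right|right].
  rewrite I_le in walk div.
  have [i [v [i0 cv nv]]] := backward_walk_full n walk div (lexx _).
  have [j [w [_ cw mw]]] := backward_walk_full m walk div i0.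
  exists (c j), (c i), w, (v ++ v0); split=> // [|a]; first exact: exec_cat cv0.
  by rewrite count_cat (leq_trans (nv a)) ?leq_addr.
by have [] := no_forward_walk walk Inat (ex_intro _ v0 cv0).
Qed.

Lemma exec_nth a0 w c k : legal w c -> k < size w ->
  exec [:: nth a0 w k] (processw (take k w) c) (processw (take k.+1 w) c).
Proof.
move=> lw kw; have : legal (take k.+1 w) c.
  move: lw; rewrite -[w in legal w](cat_take_drop k.+1).
  by rewrite legal_cat => /andP [].
by rewrite (take_nth a0) // -cats1 legal_cat processw_cat => /andP [].
Qed.

Lemma recurrent_of_cycles q u (D : nat -> config N) :
    u <> [::] -> (forall a, a \in u) -> D 0 = (0%R, q) ->
    (forall d, exec u (D d.+1) (D d)) ->
  recurrent_state q.
Proof.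
move=> u0 u_all D0 cD.
have n0 : 0 < size u by case: u u0 {u_all cD}.
have [a0 _] : {a0 | a0 \in u} 
  by case: u u0 {u_all cD n0} => // a u _; exists a; rewrite mem_head.
set n := size u in n0.
(* The walk is indexed from its end: [c k] lies [k] steps before [0.q], inside the pass of [u] from
   [D (k %/ n).+1] to [D (k %/ n)]. *)
pose c k := processw (take (n - k %% n) u) (D (k %/ n).+1).
pose l k := nth a0 u (n - k %% n).-1.
have cS k : c k.+1 = processw (take (n - k %% n).-1 u) (D (k %/ n).+1).
  rewrite /c divnS // modnS; case: ifP => [nk|_]; last by rewrite add0n subnS.
  have -> : n - k %% n = 1.
    move: nk; rewrite {1}(divn_eq k n) -addnS dvdn_addr ?dvdn_mull //.
    by have := ltn_pmod k n0 => kn /(dvdn_leq (ltn0Sn _)); lia.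
  by rewrite subn0 take_size take0 add1n; case: (cD (k %/ n).+1).
have step k : exec [:: l k] (c k.+1) (c k).
  have kn : k %% n < n by rewrite ltn_mod.
  have [lu _] := cD (k %/ n).
  rewrite cS /c /l -[in X in exec _ _ X](prednK (n := n - k %% n)) ?subn_gt0 //.
  by apply: exec_nth => //; rewrite -/n; lia.
have c_reach k : reach (c k) (0%R, q).
  have D_reach d : reach (D d) (0%R, q).
    elim: d => [|d IH]; first by rewrite D0; apply: reach_refl.
    by apply: reach_trans IH; exists u.
  apply: reach_trans (D_reach (k %/ n)); exists (drop (n - k %% n) u).
  have [lu uE] := cD (k %/ n); rewrite /c; split.
    move: lu; rewrite -{1}(cat_take_drop (n - k %% n) u).
    by rewrite legal_cat => /andP [].
  by rewrite -processw_cat cat_take_drop.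
exists [set i | (i <= 0)%R]%classic, (fun i => c `|i|%N), (fun i => l `|i|%N).
split.
- split=> [|i /= _ i0]; first exact: Or31.
  by have -> : `|i - 1|%N = `|i|.+1 by lia.
- move=> a fin; apply: infinite_nat.
  have a_lt : index a u < n by rewrite index_mem.
  apply: (sub_finite_set _ (finite_image (fun i : int => `|i| %/ n) fin)).
  (* The visit to [a] during pass number [t]; its block number is [t], so the visits map onto all
     naturals. *)
  move=> t _; exists (- (t * n + (n - (index a u).+1))%:Z)%R => /=; last first.
    rewrite abszN absz_nat divnMDl // divn_small ?addn0 //; lia.
  split; first by lia.
  rewrite /l abszN absz_nat modnMDl modn_small; last by lia.
  have -> : (n - (n - (index a u).+1)).-1 = index a u by lia.
  by rewrite nth_index.
by move=> i _; exists (0%R, q); split; [apply: reach_refl | apply: c_reach].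
Qed.

End Walks.

(** * Thief networks *)

Section ThiefNetwork.
Variables (G : digraph) (N : network G) (R : {set letter N}).
Implicit Types (a b : letter N) (q : state N) (w : seq (letter N)).

Lemma thief_transw w q : transw (N := thief R) w q = transw w q.
Proof. by []. Qed.

Lemma thief_msgw w q b :
  msgw (N := thief R) w q b = if b \in R then msgw w q b else 0.
Proof.
elim: w q => [|a w IH] q; first by rewrite !ffunE if_same.
by rewrite !(@msgw_cons _ (thief R)) (@msgw_cons _ N) thief_msg IH; case: ifP.
Qed.

(* A letter outside [R] stays legal without the messages it receives in [N] as
   long as it is provided with all its occurrences in advance. *)
Lemma thief_legal w (x y : {ffun letter N -> int}) q :
    legal w ((x, q) : config N) -> (forall a, a \in R -> x a = y a) ->
    (forall a, a \notin R -> ((count_mem a w)%:Z <= y a)%R) ->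
  legal (N := thief R) w (y, q).
Proof.
elim: w x y q => [//|a w IH] x y q /= /andP [xa lw] xy y_big; apply/andP; split.
  case: (boolP (a \in R)) => [aR|aR]; first by rewrite -xy.
  by apply: le_trans (y_big a aR); rewrite eqxx.
have yE b : ((process (N := thief R) a (y, q)).1 b =
    y b + (if b \in R then msg a q b else 0%N)%:Z - (b == a)%:Z)%R.
  by rewrite -thief_msg [LHS]ffunE.
apply: IH lw _ _ => b bR; rewrite yE; first by rewrite ffunE bR /= xy.
by rewrite (negbTE bR) addr0 lerBrDr -PoszD addnC eq_sym; exact: y_big.
Qed.

End ThiefNetwork.

(** * Recurrence in agent networks and their thief networks *)

Section AgentNetwork.
Variables (G : digraph) (N : network G).
Implicit Types (a b : letter N) (p q : state N) (u w v : seq (letter N)).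
Implicit Types (x : {ffun letter N -> nat}).

Lemma sum_msgw w q : agent_network N -> \sum_b msgw w q b = size w.
Proof.
move=> agN; elim: w q => [|a w IH] q.
  by rewrite big1 // => b _; rewrite ffunE.
under eq_bigr do rewrite msgw_cons.
by rewrite big_split /= agN IH.
Qed.

(** [D d] is the supply for [d] passes of [u]: a pass returns the letters outside [supp x] by
    balance and uses up one share of the others, which receive no messages. *)
Lemma thief_cycle x q u :
    exec u ((to_int x, q) : config N) (to_int x, q) ->
  let D d : config (thief (~: supp x)) :=
    ([ffun a => if a \in supp x then (d * count_mem a u)%:Z%R else 0%R], q) in
  forall d, exec (N := thief (~: supp x)) u (D d.+1) (D d).
Proof.
move=> cu D d; have [tu mu] := cycle_balanced cu; have [lu _] := cu.
split.
  apply: thief_legal lu _ _ => a; rewrite inE ?negbK => aS.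
    rewrite [LHS]ffunE [RHS]ffunE (negbTE aS).
    by move: aS; rewrite inE negbK => /eqP ->.
  by rewrite ffunE aS lez_nat mulSn leq_addr.
rewrite processwE thief_transw tu; congr pair; apply/ffunP => a.
rewrite [LHS]ffunE thief_msgw mu inE /= [RHS]ffunE ffunE.
case: ifP => _ /=; last by rewrite add0r subrr.
by rewrite addr0 mulSn PoszD addrC addKr.
Qed.

Lemma thief_recurrent x q : strongly_connected N -> agent_network N ->
    recurrent_config ((to_int x, q) : config N) ->
  recurrent_state (N := thief (~: supp x)) q.
Proof.
move=> scN agN [[w w0 [c' cw]] rec].
have [|v cv] := rec c'.
  by exists c'; split; [exists w | apply: reach_refl].
have cu := exec_cat cw cv.
have u0 : w ++ v <> [::] by case: w w0 {cw cu}.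
have u_all := balanced_full scN agN u0 (cycle_balanced cu).
apply: (@recurrent_of_cycles _ (thief (~: supp x)) _ _ _ u0 u_all _
  (thief_cycle cu)).
by congr pair; apply/ffunP => a; rewrite !ffunE if_same.
Qed.

(* The rest [v] of a balanced word returns each of its letters to the initial
   supply, so it sends them at least as many messages as it consumes; since the
   number of agents is constant, these bounds are equalities. *)
Lemma stuck_outside_supp x q w v : agent_network N ->
    balanced (w ++ v) q ->
    (forall a, a \in v -> x a + msgw w q a <= count_mem a w) ->
  forall a, a \in v -> x a = 0 /\ msgw w q a = count_mem a w.
Proof.
move=> agN [_ mu] stuck.
have {}mu a :
    msgw w q a + msgw v (transw w q) a = count_mem a w + count_mem a v.
  by rewrite -msgw_cat mu count_cat.
have le_v a : count_mem a v <= msgw v (transw w q) a.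
  have [/stuck|/count_memPn -> //] := boolP (a \in v).
  by have := mu a; lia.
move=> a av; have := stuck a av; have := mu a.
have : count_mem a v + \sum_(b | b != a) count_mem b v =
    msgw v (transw w q) a + \sum_(b | b != a) msgw v (transw w q) b.
  have := sum_count_mem v; rewrite -(sum_msgw v (transw w q) agN) (bigD1 a) //=.
  by rewrite [RHS](bigD1 a).
have : \sum_(b | b != a) count_mem b v <=
    \sum_(b | b != a) msgw v (transw w q) b by exact: leq_sum.
by have := le_v a; lia.
Qed.

Lemma thief_recurrent_cycle x q a0 : locally_irreducible N ->
    strongly_connected N -> agent_network N ->
    recurrent_state (N := thief (~: supp x)) q ->
  exists u, (forall a, a \in u) /\
    exec u ((to_int x, q) : config N) (to_int x, q).
Proof.
move=> irrN scN agN rec; set c : config N := (to_int x, q).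
have [u [p [u0 bu]]] := balanced_exists a0 q agN.
have u_all := balanced_full scN agN u0 bu.
(* [h0] is rich enough to make [u] balanced from [c1] on; [h1] is rich enough to contain any part of
   [u]. *)
have [c0 [c1 [h0 [h1 [[_ c01] [l1 c1q] h0_big h1_big]]]]] :=
  recurrent_history #|{: state N}| (size u) rec.
have b1 : balanced u c1.2.
  rewrite -c01 processw2E thief_transw.
  exact: balanced_saturated irrN bu h0_big.
have qE : transw h1 c1.2 = q.
  by have := congr1 snd c1q; rewrite processw2E thief_transw.
have bq : balanced u q by rewrite -qE; apply: balanced_trans.
have [w [lw wu stuck]] := legal_stuck c (fun a => count_mem a u).
have [v uv] := count_le_perm wu.
have bwv : balanced (w ++ v) q by apply: balanced_perm bq.
have {}stuck a : a \in v -> x a + msgw w q a <= count_mem a w.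
  rewrite -has_pred1 has_count => va.
  have := stuck a.
  rewrite (permP uv) count_cat -[ltnLHS]addn0 ltn_add2l => /(_ va).
  have -> : (processw w c).1 a =
      ((x a)%:Z + (msgw w q a)%:Z - (count_mem a w)%:Z)%R.
    by rewrite processw1E ffunE.
  lia.
have [v0|[a av]] : v = [::] \/ exists a, a \in v.
  by case: (v) => [|a s]; [left|right; exists a; rewrite mem_head].
  rewrite v0 cats0 in uv bwv; exists w; split=> [a|].
    by rewrite -(perm_mem uv).
  split=> //; rewrite processwE; have [-> mw] := bwv.
  by congr pair; apply/ffunP => a; rewrite ffunE mw addrK.
have [||s1 [b [s2 [h1E s_big vb sb]]]] :=
    @shortest_suffix (letter N) h1 (fun b => count_mem b v).
- move=> b; apply: leq_trans (h1_big b).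
  rewrite (leq_trans _ (count_size (pred1 b) u)) //.
  by rewrite (permP uv) count_cat leq_addl.
- by exists a; rewrite -has_count has_pred1.
have bv : b \in v by rewrite -has_pred1 has_count.
have [xb mwb] := stuck_outside_supp agN bwv stuck bv.
set s := b :: s2 in h1E s_big sb.
set c2 := processw (N := thief (~: supp x)) s1 c1.
have c2b : (1 <= c2.1 b)%R.
  by move: l1; rewrite h1E legal_cat => /andP [_ /= /andP []].
pose p2 : state N := c2.2.
have b2 : balanced u p2.
  by rewrite /p2 processw2E thief_transw; apply: balanced_trans.
have c2q : processw (N := thief (~: supp x)) s c2 = (0%R, q).
  by rewrite -processw_cat -h1E.
have tq : transw s p2 = q.
  by have := congr1 snd c2q; rewrite processw2E thief_transw.
(* As [x b = 0], the thief network keeps messages [b], so the count of [b] along [s] is the one in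
   [N]. *)
have E : (0 = c2.1 b + (msgw s p2 b)%:Z - (count_mem b v)%:Z)%R.
  have := processw1E (N := thief (~: supp x)) s c2 b.
  by rewrite c2q thief_msgw !inE xb eqxx ffunE -sb.
(* Since [s] contains [v], [s ++ w] contains [u]. Balance makes the left side the count of [b] in
   [v ++ w]; by [E] and [mwb] the right side falls short of it by [c2.1 b], which is at least 1. *)
have : msgw u p2 b <= msgw (s ++ w) p2 b.
  by apply: msgw_mono => d; rewrite (permP uv) !count_cat addnC leq_add2r.
by rewrite msgw_cat tq mwb (proj2 b2) (permP uv) count_cat; lia.
Qed.

End AgentNetwork.

Theorem lemma7p12 (G : digraph) (N : network G)
    (irrN : locally_irreducible N) (scN : strongly_connected N)
    (agN : agent_network N) (x : {ffun letter N -> nat}) (x0 : x <> 0%R)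
    (q : state N) :
  recurrent_config ((to_int x, q) : config N) <->
  recurrent_state (N := thief (~: supp x)) q.
Proof.
split; first exact: thief_recurrent.
have [a _] : exists a, x a != 0.
  apply: contrapT => xn; apply: x0; apply/ffunP => a; rewrite ffunE.
  by apply: contrapT => /eqP xa; apply: xn; exists a.
move=> /(thief_recurrent_cycle a irrN scN agN) [u [u_all cu]].
by apply: recurrent_cycle cu => // u0; have := u_all a; rewrite u0.
Qed.
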